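(* Let $X$ be a path-connected topological space with base point $x_0\in X$ and let $H\leq \pi_1(X,x_0)$ be locally quasinormal at the constant path. Suppose that the fiber $p_H^{-1}(x_0)$ is $T_1$ and that for every $x\in X$ and every path $\beta:[0,1]\rightarrow X$ from $\beta(0)=x$ to $\beta(1)=x_0$, the standard monodromy $\phi_\beta:p_H^{-1}(x)\rightarrow p_H^{-1}(x_0)$ is continuous. Then $X$ is homotopically path Hausdorff relative to $H$.
   Context: Paths are continuous maps from $[0,1]$; $\alpha\cdot\gamma$ denotes concatenation of paths, $\beta^-(t)=\beta(1-t)$ the reverse path, and $[\,\cdot\,]$ the homotopy class relative to endpoints. Construction of $p_H:\widetilde{X}_H\to X$: On the set of all paths $\alpha:([0,1],0)\rightarrow (X,x_0)$ (paths starting at $x_0$), let $\alpha\sim\beta$ if and only if $\alpha(1)=\beta(1)$ and $[\alpha\cdot\beta^-]\in H$. The equivalence class of $\alpha$ is denoted $\langle\alpha\rangle$, and $\widetilde{X}_H$ is the set of all equivalence classes. It carries the topology generated by the basis elements $\langle\alpha,U\rangle=\{\langle\alpha\cdot\gamma\rangle\mid \gamma:([0,1],0)\rightarrow (U,\alpha(1))\text{ a path}\}$, where $U\subseteq X$ is open and $\langle\alpha\rangle\in\widetilde{X}_H$ with $\alpha(1)\in U$. The map $p_H:\widetilde{X}_H\rightarrow X$ is the (continuous) endpoint projection $p_H(\langle\alpha\rangle)=\alpha(1)$. Fibers $p_H^{-1}(x)$ carry the subspace topology. Standard monodromy: for a path $\beta:[0,1]\to X$ from $x$ to $y$, $\phi_\beta:p_H^{-1}(x)\rightarrow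 p_H^{-1}(y)$ is the bijection $\phi_\beta(\langle\alpha\rangle)=\langle\alpha\cdot\beta\rangle$ (not necessarily continuous). For a path $\alpha:([0,1],0)\rightarrow (X,x_0)$ and an open neighborhood $U$ of $\alpha(1)$ in $X$, let $\pi(\alpha,U)=\{[\alpha\cdot \delta\cdot \alpha^-]\mid \delta:([0,1],\{0,1\})\rightarrow (U,\alpha(1))\}\leq \pi_1(X,x_0)$, with $\delta$ ranging over loops in $U$ based at $\alpha(1)$. A subgroup $H\leq\pi_1(X,x_0)$ is locally quasinormal at the constant path if for every open neighborhood $U$ of $x_0$ in $X$, there is an open neighborhood $V$ of $x_0$ in $X$ with $x_0\in V\subseteq U$ such that $H\pi(c,V)=\pi(c,V)H$ (equality of product sets), where $c:[0,1]\to\{x_0\}$ denotes the constant path at $x_0$. $X$ is homotopically path Hausdorff relative to $H\leq\pi_1(X,x_0)$ if for every two paths $\alpha,\beta:([0,1],0)\rightarrow (X,x_0)$ with $\alpha(1)=\beta(1)$ and $[\alpha\cdot\beta^-]\notin H$, there is a partition $0=t_0<t_1<\cdots<t_n=1$ of $[0,1]$ and open subsets $U_1,U_2,\dots,U_n$ of $X$ with $\alpha([t_{i-1},t_i])\subseteq U_i$ for all $1\leq i\leq n$ and such that if $\gamma:[0,1]\rightarrow X$ is any path with $\gamma([t_{i-1},t_i])\subseteq U_i$ for all $1\leq i\leq n$ and with $\gamma(t_i)=\alpha(t_i)$ for all $0\leq i\leq n$, then $[\gamma\cdot\beta^-]\notin H$. *)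

(* Defs.v *)
From HB Require Import structures.
From mathcomp Require Import all_boot all_order all_algebra generic_quotient.
From mathcomp Require Import all_classical all_reals all_analysis homotopy.
From mathcomp Require Import ring lra.

Set Implicit Arguments.
Unset Strict Implicit.
Unset Printing Implicit Defensive.

Import Order.TTheory GRing.Theory Num.Theory.
Import numFieldNormedType.Exports.

Local Open Scope classical_set_scope.
Local Open Scope ring_scope.

Section UnitInterval.
Variable R : realType.

Definition unit_interval : Type := `[0%R : R, 1%R]%classic.

HB.instance Definition _ :=
  Topological.copy unit_interval `[0%R : R, 1%R]%classic.

Local Notation I := unit_interval.

Definition ival (t : I) : R := \val t.

Lemma clamp_subproof (x : R) :
  Num.max 0 (Num.min 1 x) \in `[0%R : R, 1%R]%classic.
Proof.
by rewrite inE /= in_itv /= le_max lexx ge_max ler01 ge_min lexx.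
Qed.

(* The retraction of R onto the unit interval. *)
Definition clamp (x : R) : I := SigSub (clamp_subproof x).

Lemma ival_clamp (x : R) : ival (clamp x) = Num.max 0 (Num.min 1 x).
Proof. by []. Qed.

Lemma ival_itv (t : I) : 0 <= ival t <= 1.
Proof. by have := set_valP t; rewrite /= in_itv. Qed.

Lemma ival_inj : injective ival.
Proof. exact: val_inj. Qed.

Lemma clampK (x : R) : 0 <= x <= 1 -> ival (clamp x) = x.
Proof. by move=> /andP[x0 x1]; rewrite ival_clamp min_r// max_r. Qed.

Lemma ivalK (t : I) : clamp (ival t) = t.
Proof. by apply: ival_inj; rewrite clampK// ival_itv. Qed.

Lemma clamp_le0 (x : R) : x <= 0 -> clamp x = clamp 0.
Proof.
move=> x0; apply: ival_inj; rewrite !ival_clamp (min_r ler01).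
by rewrite min_r ?(le_trans x0)// maxxx max_l.
Qed.

Lemma clamp_ge1 (x : R) : 1 <= x -> clamp x = clamp 1.
Proof. by move=> x1; apply: ival_inj; rewrite !ival_clamp minxx min_l. Qed.

Lemma ival_continuous : continuous ival.
Proof. exact: initial_continuous. Qed.

Lemma clamp_continuous : continuous clamp.
Proof.
apply: continuous_comp_initial => x.
suff : {for x, continuous (cst (0 : R) \max (cst (1 : R) \min id))} by [].
apply: (@continuous_max R R); first exact: cvg_cst.
by apply: (@continuous_min R R); [exact: cvg_cst|exact: cvg_id].
Qed.

Lemma clamp01_neq : clamp 0 != clamp 1.
Proof.
apply/eqP => /(congr1 ival); rewrite !clampK ?lexx ?ler01// => /eqP.
by rewrite eq_sym oner_eq0.
Qed.

HB.instance Definition _ := isBiPointed.Build unit_interval clamp01_neq.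

Lemma ival0 : ival zero = 0. Proof. by rewrite clampK// lexx ler01. Qed.
Lemma ival1 : ival one = 1. Proof. by rewrite clampK// lexx ler01. Qed.

End UnitInterval.

Section Paste.
Variables (R : realType) (T Y : topologicalType).

Lemma continuous_paste (a : T -> R) (c : R) (f g : T -> Y) :
  continuous a -> continuous f -> continuous g ->
  (forall t, a t = c -> f t = g t) ->
  continuous (fun t => if a t <= c then f t else g t).
Proof.
move=> ca cf cg fg t; case: (ltgtP (a t) c) => [atc|atc|atc].
- have near_lt : \forall s \near t, a s < c.
    exact: cvgr_lt (ca t) _ atc.
  move=> U; rewrite (ltW atc) => /(cf t) fU.
  suff: \forall s \near t, U (if a s <= c then f s else g s) by [].
  near=> s.
  rewrite (ltW (near near_lt s _)) //; near: s; exact: fU.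
- have near_gt : \forall s \near t, c < a s by exact: cvgr_gt (ca t) _ atc.
  move=> U; rewrite leNgt atc => /(cg t) gU.
  suff: \forall s \near t, U (if a s <= c then f s else g s) by [].
  near=> s.
  rewrite leNgt (near near_gt s _) //=; near: s; exact: gU.
- move=> U; rewrite atc lexx => Uft; have fU := cf t U Uft.
  have gU : (g @ t) U by apply: cg; rewrite -fg.
  suff: \forall s \near t, U (if a s <= c then f s else g s) by [].
  near=> s.
  by case: ifP => _; near: s; [exact: fU|exact: gU].
Unshelve. all: by end_near. Qed.

End Paste.

Section Paths.
Variables (R : realType) (X : topologicalType).
Local Notation I := (unit_interval R).
Implicit Types x y z : X.

Lemma path_cts x y (f : {path I from x to y}) : continuous f.
Proof. exact: cts_fun. Qed.

Lemma path0 x y (f : {path I from x to y}) : f (clamp 0) = x.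
Proof. exact: path_zero. Qed.

Lemma path1 x y (f : {path I from x to y}) : f (clamp 1) = y.
Proof. exact: path_one. Qed.

Definition path_cat_fun (f g : I -> X) (t : I) : X :=
  if ival t <= 2^-1 then f (clamp (2 * ival t))
  else g (clamp (2 * ival t - 1)).

Definition path_rev_fun (f : I -> X) (t : I) : X := f (clamp (1 - ival t)).

Lemma affine_continuous (T : topologicalType) (u : T -> R) (a b : R) :
  continuous u -> continuous (fun t => a * u t + b).
Proof.
move=> cu t; apply: cvgD; last exact: cvg_cst.
exact: (cvgM (cvg_cst a) (cu t)).
Qed.

Lemma clamp_cts (T : topologicalType) (u : T -> R) :
  continuous u -> continuous (fun t => clamp (u t)).
Proof.
by move=> cu t; apply: continuous_comp; [exact: cu|exact: clamp_continuous].
Qed.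

Lemma clamp_dbl_cts : continuous (fun t : I => clamp (2 * ival t)).
Proof.
by apply: clamp_cts => t; exact: (cvgM (cvg_cst _) (@ival_continuous R t)).
Qed.

Lemma clamp_dbl1_cts : continuous (fun t : I => clamp (2 * ival t - 1)).
Proof.
by apply: clamp_cts; apply: affine_continuous; exact: ival_continuous.
Qed.

Lemma clamp_opp_cts : continuous (fun t : I => clamp (1 - ival t)).
Proof.
by apply: clamp_cts => t; exact: (cvgB (cvg_cst _) (@ival_continuous R t)).
Qed.

Lemma comp_cts (T U V : topologicalType) (f : T -> U) (g : U -> V) :
  continuous f -> continuous g -> continuous (fun t => g (f t)).
Proof. by move=> cf cg t; apply: continuous_comp; [exact: cf|exact: cg]. Qed.

Section PathOps.
Variables (x y z : X) (f : {path I from x to y}) (g : {path I from y to z}).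

Lemma path_cat_cts : continuous (path_cat_fun f g).
Proof.
apply: continuous_paste.
- exact: ival_continuous.
- apply: comp_cts; [exact: clamp_dbl_cts|exact: path_cts].
- apply: comp_cts; [exact: clamp_dbl1_cts|exact: path_cts].
- by move=> t ->; rewrite mulfV// subrr path1 path0.
Qed.

Lemma path_cat_zero : path_cat_fun f g zero = x.
Proof. by rewrite /path_cat_fun ival0 mulr0 invr_ge0 ler0n path0. Qed.

Lemma path_cat_one : path_cat_fun f g one = z.
Proof.
rewrite /path_cat_fun ival1 ifF; last by apply/negP; lra.
by rewrite (_ : 2 * 1 - 1 = 1 :> R) ?path1//; ring.
Qed.

Definition path_cat : {path I from x to z} :=
  mk_path path_cat_cts path_cat_zero path_cat_one.

Lemma path_rev_cts : continuous (path_rev_fun f).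
Proof. by apply: comp_cts; [exact: clamp_opp_cts|exact: path_cts]. Qed.

Lemma path_rev_zero : path_rev_fun f zero = y.
Proof. by rewrite /path_rev_fun ival0 subr0 path1. Qed.

Lemma path_rev_one : path_rev_fun f one = x.
Proof. by rewrite /path_rev_fun ival1 subrr path0. Qed.

Definition path_rev : {path I from y to x} :=
  mk_path path_rev_cts path_rev_zero path_rev_one.

End PathOps.

Definition path_cst x : {path I from x to x} := cst x.

Lemma path_catE x y z (f : {path I from x to y}) (g : {path I from y to z}) t :
  path_cat f g t = if ival t <= 2^-1 then f (clamp (2 * ival t))
                   else g (clamp (2 * ival t - 1)).
Proof. by []. Qed.

Lemma path_revE x y (f : {path I from x to y}) t :
  path_rev f t = f (clamp (1 - ival t)).
Proof. by []. Qed.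

Definition path_homotopic x y (f g : {path I from x to y}) : Prop :=
  exists h : I * I -> X,
    [/\ continuous h,
        forall t, h (t, zero) = f t, forall t, h (t, one) = g t,
        forall s, h (zero, s) = x & forall s, h (one, s) = y].

End Paths.

Section Homotopy.
Variables (R : realType) (X : topologicalType).
Local Notation I := (unit_interval R).
Implicit Types x y z w : X.

Lemma pair_cts (T U V : topologicalType) (f : T -> U) (g : T -> V) :
  continuous f -> continuous g -> continuous (fun t => (f t, g t)).
Proof. by move=> cf cg t; apply: cvg_pair; [exact: cf|exact: cg]. Qed.

Lemma fst_cts (T U : topologicalType) : continuous (@fst T U).
Proof. by move=> ?; exact: cvg_fst. Qed.

Lemma snd_cts (T U : topologicalType) : continuous (@snd T U).
Proof. by move=> ?; exact: cvg_snd. Qed.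

Lemma path_homotopic_refl x y (f : {path I from x to y}) : path_homotopic f f.
Proof.
exists (fun ts => f ts.1); split=> //=.
- exact: (comp_cts (@fst_cts _ _) (@path_cts _ _ _ _ _)).
- by move=> s; rewrite path_zero.
- by move=> s; rewrite path_one.
Qed.

Lemma clamp_opp0 : clamp (1 - ival (zero : I)) = one.
Proof. by rewrite ival0 subr0. Qed.

Lemma clamp_opp1 : clamp (1 - ival (one : I)) = zero.
Proof. by rewrite ival1 subrr. Qed.

Lemma path_homotopic_sym x y (f g : {path I from x to y}) :
  path_homotopic f g -> path_homotopic g f.
Proof.
move=> [h [hc h0 h1 hx hy]].
exists (fun ts => h (ts.1, clamp (1 - ival ts.2))); split=> /=.
- apply: comp_cts; last exact: hc.
  apply: pair_cts; first exact: fst_cts.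
  exact: (comp_cts (@snd_cts _ _) (@clamp_opp_cts R)).
- by move=> t; rewrite clamp_opp0.
- by move=> t; rewrite clamp_opp1.
- by move=> s; rewrite hx.
- by move=> s; rewrite hy.
Qed.

Lemma path_homotopic_trans x y (f g k : {path I from x to y}) :
  path_homotopic f g -> path_homotopic g k -> path_homotopic f k.
Proof.
move=> [h [hc h0 h1 hx hy]] [h' [hc' h0' h1' hx' hy']].
exists (fun ts => if ival ts.2 <= 2^-1 then h (ts.1, clamp (2 * ival ts.2))
                  else h' (ts.1, clamp (2 * ival ts.2 - 1))); split=> /=.
- apply: continuous_paste.
  + exact: (comp_cts (@snd_cts _ _) (@ival_continuous R)).
  + apply: comp_cts; last exact: hc.
    apply: pair_cts; first exact: fst_cts.
    exact: (comp_cts (@snd_cts _ _) (@clamp_dbl_cts R)).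
  + apply: comp_cts; last exact: hc'.
    apply: pair_cts; first exact: fst_cts.
    exact: (comp_cts (@snd_cts _ _) (@clamp_dbl1_cts R)).
  + by move=> t ->; rewrite mulfV// subrr h1 h0'.
- by move=> t; rewrite ival0 mulr0 invr_ge0 ler0n h0.
- move=> t; rewrite ival1 ifF; last by apply/negP; lra.
  by rewrite (_ : 2 * 1 - 1 = 1 :> R) ?h1'//; ring.
- by move=> s; case: ifP; rewrite ?hx ?hx'.
- by move=> s; case: ifP; rewrite ?hy ?hy'.
Qed.

Lemma path_homotopic_cat x y z (f f' : {path I from x to y})
    (g g' : {path I from y to z}) :
  path_homotopic f f' -> path_homotopic g g' ->
  path_homotopic (path_cat f g) (path_cat f' g').
Proof.
move=> [h [hc h0 h1 hx hy]] [h' [hc' h0' h1' hx' hy']].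
exists (fun ts => if ival ts.1 <= 2^-1 then h (clamp (2 * ival ts.1), ts.2)
                  else h' (clamp (2 * ival ts.1 - 1), ts.2)); split=> /=.
- apply: continuous_paste.
  + exact: (comp_cts (@fst_cts _ _) (@ival_continuous R)).
  + apply: comp_cts; last exact: hc.
    apply: pair_cts; last exact: snd_cts.
    exact: (comp_cts (@fst_cts _ _) (@clamp_dbl_cts R)).
  + apply: comp_cts; last exact: hc'.
    apply: pair_cts; last exact: snd_cts.
    exact: (comp_cts (@fst_cts _ _) (@clamp_dbl1_cts R)).
  + by move=> t ->; rewrite mulfV// subrr hy hx'.
- by move=> t; rewrite h0 h0'.
- by move=> t; rewrite h1 h1'.
- by move=> s; rewrite ival0 mulr0 invr_ge0 ler0n hx.
- move=> s; rewrite ival1 ifF; last by apply/negP; lra.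
  by rewrite (_ : 2 * 1 - 1 = 1 :> R) ?hy'//; ring.
Qed.

Lemma path_homotopic_rev x y (f g : {path I from x to y}) :
  path_homotopic f g -> path_homotopic (path_rev f) (path_rev g).
Proof.
move=> [h [hc h0 h1 hx hy]].
exists (fun ts => h (clamp (1 - ival ts.1), ts.2)); split=> /=.
- apply: comp_cts; last exact: hc.
  apply: pair_cts; last exact: snd_cts.
  exact: (comp_cts (@fst_cts _ _) (@clamp_opp_cts R)).
- by move=> t; rewrite h0.
- by move=> t; rewrite h1.
- by move=> s; rewrite clamp_opp0 hy.
- by move=> s; rewrite clamp_opp1 hx.
Qed.

(* Straight-line homotopy between two reparametrizations of one path. *)
Lemma path_homotopic_reparam x y u v (f : {path I from x to y})
    (g g' : {path I from u to v}) (phi psi : I -> R) :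
  continuous phi -> continuous psi ->
  phi zero = psi zero -> phi one = psi one ->
  (forall t, g t = f (clamp (phi t))) -> (forall t, g' t = f (clamp (psi t))) ->
  path_homotopic g g'.
Proof.
move=> cphi cpsi e0 e1 gE g'E.
exists (fun ts => f (clamp (phi ts.1 + ival ts.2 * (psi ts.1 - phi ts.1)))).
split=> /=.
- apply: comp_cts; last exact: path_cts.
  apply: clamp_cts => ts.
  have c1 : {for ts, continuous (fun ts : I * I => phi ts.1)}.
    exact: (comp_cts (@fst_cts _ _) cphi).
  have c2 : {for ts, continuous (fun ts : I * I => psi ts.1)}.
    exact: (comp_cts (@fst_cts _ _) cpsi).
  have c3 : {for ts, continuous (fun ts : I * I => ival ts.2)}.
    exact: (comp_cts (@snd_cts _ _) (@ival_continuous R)).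
  exact: (cvgD c1 (cvgM c3 (cvgB c2 c1))).
- by move=> t; rewrite ival0 mul0r addr0 gE.
- by move=> t; rewrite ival1 mul1r addrC subrK g'E.
- by move=> s; rewrite -e0 subrr mulr0 addr0 -gE path_zero.
- by move=> s; rewrite -e1 subrr mulr0 addr0 -gE path_one.
Qed.

Lemma dbl_cts : continuous (fun t : I => 2 * ival t).
Proof. by move=> t; exact: (cvgM (cvg_cst _) (@ival_continuous R t)). Qed.

Lemma min_cts (phi psi : I -> R) : continuous phi -> continuous psi ->
  continuous (fun t => Num.min (phi t) (psi t)).
Proof.
move=> cphi cpsi t; suff : {for t, continuous (phi \min psi)} by [].
by apply: (@continuous_min R I); [exact: cphi|exact: cpsi].
Qed.

Lemma max_cts (phi psi : I -> R) : continuous phi -> continuous psi ->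
  continuous (fun t => Num.max (phi t) (psi t)).
Proof.
move=> cphi cpsi t; suff : {for t, continuous (phi \max psi)} by [].
by apply: (@continuous_max R I); [exact: cphi|exact: cpsi].
Qed.

Lemma path_homotopic_cat_cst x y (f : {path I from x to y}) :
  path_homotopic (path_cat f (path_cst R y)) f.
Proof.
apply: (@path_homotopic_reparam _ _ _ _ f _ _
  (fun t => Num.min 1 (2 * ival t)) (@ival R)).
- by apply: min_cts; [exact: cst_continuous|exact: dbl_cts].
- exact: ival_continuous.
- by rewrite ival0 mulr0 min_r// ler01.
- by rewrite ival1 min_l//; lra.
- move=> t; rewrite path_catE; have /andP[t0 t1] := ival_itv t.
  case: (leP (ival t) 2^-1) => ht; first by rewrite min_r//; lra.
  by rewrite min_l ?path1//; lra.
- by move=> t; rewrite ivalK.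
Qed.

Lemma path_homotopic_cst_cat x y (f : {path I from x to y}) :
  path_homotopic (path_cat (path_cst R x) f) f.
Proof.
apply: (@path_homotopic_reparam _ _ _ _ f _ _
  (fun t => Num.max 0 (2 * ival t - 1)) (@ival R)).
- apply: max_cts; first by exact: cst_continuous.
  by apply: affine_continuous; exact: ival_continuous.
- exact: ival_continuous.
- by rewrite ival0 max_l//; lra.
- by rewrite ival1 max_r//; lra.
- move=> t; rewrite path_catE; have /andP[t0 t1] := ival_itv t.
  case: (leP (ival t) 2^-1) => ht; first by rewrite max_l ?path0//; lra.
  by rewrite max_r//; lra.
- by move=> t; rewrite ivalK.
Qed.

Lemma path_homotopic_cat_rev x y (f : {path I from x to y}) :
  path_homotopic (path_cat f (path_rev f)) (path_cst R x).
Proof.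
apply: (@path_homotopic_reparam _ _ _ _ f _ _
  (fun t => Num.min (2 * ival t) (- 2 * ival t + 2)) (fun=> 0)).
- apply: min_cts; first exact: dbl_cts.
  by apply: affine_continuous; exact: ival_continuous.
- by exact: cst_continuous.
- by rewrite ival0 min_l; lra.
- by rewrite ival1 min_r; lra.
- move=> t; rewrite path_catE; have /andP[t0 t1] := ival_itv t.
  case: (leP (ival t) 2^-1) => ht; first by rewrite min_l//; lra.
  rewrite path_revE min_r; last by lra.
  by rewrite clampK; [congr (f (clamp _)); ring|lra].
- by move=> t; rewrite path0.
Qed.

Lemma path_revK x y (f : {path I from x to y}) : path_rev (path_rev f) = f.
Proof.
apply/path_eqP => t; rewrite !path_revE; have /andP[t0 t1] := ival_itv t.
by rewrite clampK; [rewrite opprB addrC subrK ivalK|lra].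
Qed.

Lemma path_homotopic_rev_cat x y (f : {path I from x to y}) :
  path_homotopic (path_cat (path_rev f) f) (path_cst R y).
Proof. by rewrite -{2}[f]path_revK; exact: path_homotopic_cat_rev. Qed.

Lemma path_homotopic_catA x y z w (f : {path I from x to y})
    (g : {path I from y to z}) (h : {path I from z to w}) :
  path_homotopic (path_cat f (path_cat g h)) (path_cat (path_cat f g) h).
Proof.
apply: path_homotopic_sym.
apply: (@path_homotopic_reparam _ _ _ _ (path_cat f (path_cat g h)) _ _
  (fun t => Num.min (Num.min (2 * ival t) (1 * ival t + 4^-1))
                    (2^-1 * ival t + 2^-1)) (@ival R)).
- apply: min_cts; last by apply: affine_continuous; exact: ival_continuous.
  apply: min_cts; first exact: dbl_cts.
  by apply: affine_continuous; exact: ival_continuous.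
- exact: ival_continuous.
- by rewrite ival0 min_l min_l; lra.
- by rewrite ival1 min_r ?min_r; lra.
- move=> t; have /andP[t0 t1] := ival_itv t.
  rewrite path_catE; case: (leP (ival t) 2^-1) => t2.
    rewrite path_catE clampK; last by lra.
    rewrite (min_l (y := _ + 2^-1)); last by rewrite ge_min; lra.
    case: (leP (2 * ival t) 2^-1) => t3.
      rewrite min_l; last by lra.
      rewrite path_catE clampK; last by lra.
      by rewrite ifT; last by lra.
    rewrite min_r; last by lra.
    rewrite path_catE clampK; last by lra.
    rewrite ifF; last by apply/negP; lra.
    rewrite path_catE clampK; last by lra.
    by rewrite ifT; [congr (g (clamp _)); lra|lra].
  rewrite min_r; last by rewrite le_min; apply/andP; split; lra.
  rewrite path_catE clampK; last by lra.
  rewrite ifF; last by apply/negP; lra.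
  rewrite path_catE clampK; last by lra.
  rewrite ifF; last by apply/negP; lra.
  by congr (h (clamp _)); lra.
- by move=> t; rewrite ivalK.
Qed.

End Homotopy.

Section FundamentalGroupoid.
Variables (R : realType) (X : topologicalType).
Local Notation I := (unit_interval R).
Implicit Types x y z w : X.

Section Classes.
Variables x y : X.

Definition homotopicb (f g : {path I from x to y}) : bool :=
  `[< path_homotopic f g >].

Lemma homotopicb_refl : reflexive homotopicb.
Proof. by move=> f; apply/asboolP; exact: path_homotopic_refl. Qed.

Lemma homotopicb_sym : symmetric homotopicb.
Proof.
by move=> f g; apply/asboolP/asboolP; exact: path_homotopic_sym.
Qed.

Lemma homotopicb_trans : transitive homotopicb.
Proof.
move=> g f h /asboolP fg /asboolP gh; apply/asboolP.
exact: path_homotopic_trans gh.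
Qed.

Canonical homotopicb_equiv :=
  EquivRel homotopicb homotopicb_refl homotopicb_sym homotopicb_trans.

Definition path_class := {eq_quot homotopicb}%qT.

HB.instance Definition _ := Choice.on path_class.

Definition pclass (f : {path I from x to y}) : path_class :=
  (\pi_({eq_quot homotopicb}) f)%qT.

Lemma pclassP f g : pclass f = pclass g <-> path_homotopic f g.
Proof. by split=> [/eqquotP/asboolP//|fg]; apply/eqquotP/asboolP. Qed.

Definition prepr (u : path_class) : {path I from x to y} := repr u.

Lemma preprK u : pclass (prepr u) = u.
Proof. exact: reprK. Qed.

Lemma prepr_homotopic f : path_homotopic (prepr (pclass f)) f.
Proof. by apply/pclassP; rewrite preprK. Qed.

End Classes.

Definition pclass_mul x y z (u : path_class x y) (v : path_class y z) :
  path_class x z := pclass (path_cat (prepr u) (prepr v)).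

Definition pclass_inv x y (u : path_class x y) : path_class y x :=
  pclass (path_rev (prepr u)).

Definition pclass_one x : path_class x x := pclass (path_cst R x).

Lemma pclass_cat x y z (f : {path I from x to y}) (g : {path I from y to z}) :
  pclass (path_cat f g) = pclass_mul (pclass f) (pclass g).
Proof.
by apply/pclassP; apply: path_homotopic_cat;
  apply: path_homotopic_sym; exact: prepr_homotopic.
Qed.

Lemma pclass_rev x y (f : {path I from x to y}) :
  pclass (path_rev f) = pclass_inv (pclass f).
Proof.
apply/pclassP; apply: path_homotopic_rev.
by apply: path_homotopic_sym; exact: prepr_homotopic.
Qed.

Lemma pclass_mulA x y z w (a : path_class x y) (b : path_class y z)
    (c : path_class z w) :
  pclass_mul a (pclass_mul b c) = pclass_mul (pclass_mul a b) c.
Proof.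
rewrite -[a]preprK -[b]preprK -[c]preprK -!pclass_cat.
by apply/pclassP; exact: path_homotopic_catA.
Qed.

Lemma pclass_mul1p x y (a : path_class x y) : pclass_mul (pclass_one x) a = a.
Proof.
rewrite -[a]preprK -!pclass_cat.
by apply/pclassP; exact: path_homotopic_cst_cat.
Qed.

Lemma pclass_mulp1 x y (a : path_class x y) : pclass_mul a (pclass_one y) = a.
Proof.
rewrite -[a]preprK -!pclass_cat.
by apply/pclassP; exact: path_homotopic_cat_cst.
Qed.

Lemma pclass_mulV x y (a : path_class x y) :
  pclass_mul a (pclass_inv a) = pclass_one x.
Proof.
rewrite -[a]preprK -pclass_rev -!pclass_cat.
by apply/pclassP; exact: path_homotopic_cat_rev.
Qed.

Lemma pclass_Vmul x y (a : path_class x y) :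
  pclass_mul (pclass_inv a) a = pclass_one y.
Proof.
rewrite -[a]preprK -pclass_rev -!pclass_cat.
by apply/pclassP; exact: path_homotopic_rev_cat.
Qed.

Lemma pclass_mulKV x y z (a : path_class x y) (b : path_class z y) :
  pclass_mul (pclass_mul a (pclass_inv b)) b = a.
Proof. by rewrite -pclass_mulA pclass_Vmul pclass_mulp1. Qed.

Lemma pclass_mulK x y z (a : path_class x y) (b : path_class y z) :
  pclass_mul (pclass_mul a b) (pclass_inv b) = a.
Proof. by rewrite -pclass_mulA pclass_mulV pclass_mulp1. Qed.

Lemma pclass_invP x y (a : path_class x y) (b : path_class y x) :
  pclass_mul a b = pclass_one x -> b = pclass_inv a.
Proof.
move=> ab; rewrite -[RHS]pclass_mulp1 -ab pclass_mulA pclass_Vmul.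
by rewrite pclass_mul1p.
Qed.

Lemma pclass_invM x y z (a : path_class x y) (b : path_class y z) :
  pclass_inv (pclass_mul a b) = pclass_mul (pclass_inv b) (pclass_inv a).
Proof.
apply/esym/pclass_invP; rewrite pclass_mulA pclass_mulK.
exact: pclass_mulV.
Qed.

Lemma pclass_invK x y (a : path_class x y) : pclass_inv (pclass_inv a) = a.
Proof. by apply/esym/pclass_invP; exact: pclass_Vmul. Qed.

Definition pi1 x : Type := path_class x x.

HB.instance Definition _ x := Choice.on (pi1 x).
HB.instance Definition _ x := isGroup.Build (pi1 x)
  (@pclass_mulA x x x x) (@pclass_mul1p x x) (@pclass_mulp1 x x)
  (@pclass_Vmul x x) (@pclass_mulV x x).

Lemma pi1_mulE x (u v : pi1 x) : (u * v)%g = pclass_mul u v.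
Proof. by []. Qed.

Lemma pi1_invE x (u : pi1 x) : (u^-1)%g = pclass_inv u.
Proof. by []. Qed.

End FundamentalGroupoid.

Arguments pi1 R {X} x.

Section EndpointCover.
Variables (R : realType) (X : topologicalType) (x0 : X).
Local Notation I := (unit_interval R).
Local Open Scope quotient_scope.

Definition path_from : Type := {x : X & {path I from x0 to x}}.

HB.instance Definition _ := Choice.on path_from.
HB.instance Definition _ :=
  isPointed.Build path_from (existT _ x0 (path_cst R x0)).

Variable H : groupClosed (pi1 R x0).

(* The witness x in this existential is the common endpoint, so the two paths
   can be concatenated without transport. *)
Definition cover_rel (a b : path_from) : Prop :=
  exists x (f g : {path I from x0 to x}),
    [/\ a = existT _ x f, b = existT _ x g &
        (pclass (path_cat f (path_rev g)) : pi1 R x0) \in H].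

Lemma cover_rel_existT x (f g : {path I from x0 to x}) :
  cover_rel (existT _ x f) (existT _ x g) <->
  (pclass (path_cat f (path_rev g)) : pi1 R x0) \in H.
Proof.
split=> [[y [f' [g' [ef eg]]]]|fgH]; last by exists x, f, g.
have exy : x = y by have /= := congr1 (@projT1 _ _) ef.
by subst y; rewrite (existT_inj2 ef) (existT_inj2 eg).
Qed.

Definition cover_relb (a b : path_from) : bool := `[< cover_rel a b >].

Lemma cover_relb_refl : reflexive cover_relb.
Proof.
move=> [x f]; apply/asboolP/cover_rel_existT.
by rewrite pclass_cat pclass_rev pclass_mulV; exact: (@gpred1 _ H).
Qed.

Lemma cover_rel_sym a b : cover_rel a b -> cover_rel b a.
Proof.
move=> [x [f [g [-> -> fgH]]]]; apply/cover_rel_existT.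
move: fgH; rewrite !pclass_cat !pclass_rev => /(@gpredVr _ H).
by rewrite pi1_invE pclass_invM pclass_invK.
Qed.

Lemma cover_relb_sym : symmetric cover_relb.
Proof. by move=> a b; apply/asboolP/asboolP; exact: cover_rel_sym. Qed.

Lemma cover_relb_trans : transitive cover_relb.
Proof.
move=> b a c /asboolP [x [f [g [-> -> fgH]]]] /asboolP [y [g' [h []]]] eg.
have exy : x = y by have /= := congr1 (@projT1 _ _) eg.
subst y; rewrite -(existT_inj2 eg) => -> ghH.
apply/asboolP/cover_rel_existT.
have := gpredM _ _ fgH ghH; rewrite pi1_mulE.
by rewrite !pclass_cat pclass_mulA !pclass_rev pclass_mulKV.
Qed.

Canonical cover_equiv :=
  EquivRel cover_relb cover_relb_refl cover_relb_sym cover_relb_trans.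

(* The space written X~_H in the literature; its topology, generated by the sets
   <f, U> = cover_basic f U with U open and f(1) in U, is declared below. *)
Definition cover : Type := {eq_quot cover_relb}.

HB.instance Definition _ := Choice.on cover.

Definition cover_class x (f : {path I from x0 to x}) : cover :=
  \pi_({eq_quot cover_relb}) (existT _ x f : path_from).

Lemma cover_classP x (f g : {path I from x0 to x}) :
  cover_class f = cover_class g <->
  (pclass (path_cat f (path_rev g)) : pi1 R x0) \in H.
Proof.
rewrite -cover_rel_existT.
by split=> [/eqquotP/asboolP//|fg]; apply/eqquotP/asboolP.
Qed.

Definition cover_repr (u : cover) : path_from := repr u.

Definition cover_proj (u : cover) : X := projT1 (cover_repr u).

Lemma cover_reprK u : cover_class (projT2 (cover_repr u)) = u.
Proof.
rewrite /cover_class (_ : existT _ _ _ = cover_repr u); last first.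
  by case: (cover_repr u).
exact: reprK.
Qed.

Lemma cover_proj_class x (f : {path I from x0 to x}) :
  cover_proj (cover_class f) = x.
Proof.
have /eqquotP/asboolP[y [g [h [e1 e2 _]]]] := cover_reprK (cover_class f).
rewrite /cover_proj; move: (congr1 (@projT1 _ _) e1) => /= ->.
by have /= := congr1 (@projT1 _ _) e2.
Qed.

Lemma cover_class_eqx x y (f : {path I from x0 to x})
    (g : {path I from x0 to y}) : cover_class f = cover_class g -> x = y.
Proof. by move=> e; rewrite -(cover_proj_class f) e cover_proj_class. Qed.

Lemma cover_class_cat x y (f g : {path I from x0 to x})
    (b : {path I from x to y}) :
  cover_class f = cover_class g ->
  cover_class (path_cat f b) = cover_class (path_cat g b).
Proof.
move=> /cover_classP fgH; apply/cover_classP; move: fgH.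
rewrite !pclass_cat !pclass_rev !pclass_cat pclass_invM.
by rewrite !pclass_mulA pclass_mulK.
Qed.

Lemma cover_class_homotopic x (f g : {path I from x0 to x}) :
  path_homotopic f g -> cover_class f = cover_class g.
Proof.
move=> /pclassP fg; apply/cover_classP; rewrite pclass_cat pclass_rev fg.
by rewrite pclass_mulV; exact: (@gpred1 _ H).
Qed.

Definition cover_basic x (f : {path I from x0 to x}) (U : set X) : set cover :=
  [set w | exists y (g : {path I from x to y}),
     (forall t, U (g t)) /\ w = cover_class (path_cat f g)].

Definition cover_index : set (path_from * set X) :=
  [set aU | open aU.2 /\ aU.2 (projT1 aU.1)].

Definition cover_base (aU : path_from * set X) : set cover :=
  cover_basic (projT2 aU.1) aU.2.

Lemma path_cat_in x y z (f : {path I from x to y}) (g : {path I from y to z})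
    (U : set X) :
  (forall t, U (f t)) -> (forall t, U (g t)) -> forall t, U (path_cat f g t).
Proof. by move=> Uf Ug t; rewrite path_catE; case: ifP. Qed.

Lemma cover_basic_trans x y (f : {path I from x0 to x})
    (g : {path I from x to y}) (U : set X) : (forall t, U (g t)) ->
  cover_basic (path_cat f g) U `<=` cover_basic f U.
Proof.
move=> Ug _ [z [h [Uh ->]]]; exists z, (path_cat g h); split.
  exact: path_cat_in.
by apply: cover_class_homotopic; apply: path_homotopic_sym;
  exact: path_homotopic_catA.
Qed.

Lemma cover_basicS x (f : {path I from x0 to x}) (U V : set X) :
  U `<=` V -> cover_basic f U `<=` cover_basic f V.
Proof.
by move=> UV _ [z [h [Uh ->]]]; exists z, h; split=> // t; exact: UV.
Qed.

Lemma cover_basic_eq x y (f : {path I from x0 to x})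
    (g : {path I from x0 to y}) (U : set X) :
  cover_class f = cover_class g -> cover_basic f U = cover_basic g U.
Proof.
move=> fg; have exy := cover_class_eqx fg; subst y.
by apply/seteqP; split=> _ [z [h [Uh ->]]]; exists z, h; split=> //;
  apply: cover_class_cat.
Qed.

Lemma cover_basic_self x (f : {path I from x0 to x}) (U : set X) :
  U x -> cover_basic f U (cover_class f).
Proof.
move=> Ux; exists x, (path_cst R x); split=> //.
by apply: cover_class_homotopic; apply: path_homotopic_sym;
  exact: path_homotopic_cat_cst.
Qed.

Lemma cover_base_cover : \bigcup_(aU in cover_index) cover_base aU = setT.
Proof.
apply/seteqP; split=> // u _; exists (cover_repr u, setT).
  by split=> //; exact: openT.
by rewrite -{2}[u]cover_reprK; exact: cover_basic_self.
Qed.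

Lemma cover_base_join i j t : cover_index i -> cover_index j ->
  cover_base i t -> cover_base j t ->
  exists k, [/\ cover_index k, cover_base k t &
                cover_base k `<=` cover_base i `&` cover_base j].
Proof.
case: i j => [[x f] U] [[y g] V] [/= oU Ux] [/= oV Vy].
move=> [z [h [Uh th]]] [z' [h' [Vh' th']]].
have ezz : z = z' by apply: cover_class_eqx (etrans (esym th) th').
subst z'; have UVz : (U `&` V) z.
  by split; [have := Uh (clamp 1)|have := Vh' (clamp 1)]; rewrite path1.
exists (existT _ z (path_cat f h), U `&` V); split => /=.
- by split; [exact: openI|].
- by rewrite th; exact: cover_basic_self.
- move=> w kw; split.
    by apply: (cover_basic_trans Uh); apply: cover_basicS kw => ? [].
  apply: (cover_basic_trans Vh').
  rewrite -(cover_basic_eq _ (etrans (esym th) th')).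
  by apply: cover_basicS kw => ? [].
Qed.

HB.instance Definition _ :=
  isBaseTopological.Build cover cover_base_cover cover_base_join.

Definition fiber (x : X) : set cover := cover_proj @^-1` [set x].

Lemma fiber_class x (f : {path I from x0 to x}) :
  cover_class f \in fiber x.
Proof. by rewrite inE /fiber /= cover_proj_class. Qed.

Lemma fiberE x (u : fiber x) : projT1 (cover_repr (\val u)) = x.
Proof. exact: set_valP u. Qed.

Definition fiber_path x (u : fiber x) : {path I from x0 to x} :=
  ecast z {path I from x0 to z} (fiberE u) (projT2 (cover_repr (\val u))).

Lemma fiber_pathK x (u : fiber x) : cover_class (fiber_path u) = \val u.
Proof.
have castE (a : path_from) y (e : projT1 a = y) :
    cover_class (ecast z {path I from x0 to z} e (projT2 a)) =
    cover_class (projT2 a) by case: y / e.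
by rewrite castE cover_reprK.
Qed.

(* fiber_path chooses a representative; the result does not depend on it, see
   monodromy_class. *)
Definition monodromy x y (b : {path I from x to y}) (u : fiber x) : fiber y :=
  SigSub (fiber_class (path_cat (fiber_path u) b)).

Lemma monodromy_class x y (b : {path I from x to y})
    (f : {path I from x0 to x}) :
  \val (monodromy b (SigSub (fiber_class f))) = cover_class (path_cat f b).
Proof. by apply: cover_class_cat; rewrite fiber_pathK. Qed.

End EndpointCover.

Arguments cover {R X x0} H.
Arguments cover_class {R X x0} H {x} f.
Arguments cover_proj {R X x0 H} u.
Arguments cover_basic {R X x0} H {x} f U.
Arguments fiber {R X x0} H x.
Arguments monodromy {R X x0} H {x y} b u.

Section Notions.
Variables (R : realType) (X : topologicalType).
Local Notation I := (unit_interval R).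

Definition path_connected : Prop :=
  forall x y : X, [set: {path I from x to y}] !=set0.

Definition pi_path (x0 x : X) (f : {path I from x0 to x}) (U : set X) :
    set (pi1 R x0) :=
  [set u | exists d : {path I from x to x},
     (forall t, U (d t)) /\ u = pclass (path_cat (path_cat f d) (path_rev f))].

Definition set_mulg (G : groupType) (A B : set G) : set G :=
  [set (a * b)%g | a in A & b in B].

Definition locally_quasinormal_cst (x0 : X) (H : groupClosed (pi1 R x0)) :
    Prop :=
  forall U : set X, open U -> U x0 ->
    exists V : set X, [/\ open V, V x0, V `<=` U &
      set_mulg [set` H] (pi_path (path_cst R x0) V) =
      set_mulg (pi_path (path_cst R x0) V) [set` H]].

(* Only the points t 0, .., t n and the sets U 0, .., U n.-1 matter; U i covers
   [t i, t i.+1]. The path h passes through f (t 0) = x0 and f (t n) = x, hence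
   its type. *)
Definition homotopically_path_hausdorff (x0 : X) (H : groupClosed (pi1 R x0)) :
    Prop :=
  forall (x : X) (f g : {path I from x0 to x}),
    (pclass (path_cat f (path_rev g)) : pi1 R x0) \notin H ->
    exists (n : nat) (t : nat -> I) (U : nat -> set X),
      [/\ t 0%N = zero, t n = one,
          forall i, (i < n)%N -> ival (t i) < ival (t i.+1),
          forall i, (i < n)%N -> open (U i) /\
            forall s, ival (t i) <= ival s <= ival (t i.+1) -> U i (f s) &
          forall h : {path I from x0 to x},
            (forall i, (i < n)%N ->
               forall s, ival (t i) <= ival s <= ival (t i.+1) -> U i (h s)) ->
            (forall i, (i <= n)%N -> h (t i) = f (t i)) ->
            (pclass (path_cat h (path_rev g)) : pi1 R x0) \notin H].

End Notions.

(* Main.v *)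
Require Import Defs.
From HB Require Import structures.
From mathcomp Require Import all_boot all_order all_algebra.
From mathcomp Require Import all_classical all_reals all_analysis homotopy.
From mathcomp Require Import ring lra.

(** Write [pi(f, U)] for [pi_path f U], [c] for the constant path at [x0],
    [f_s] for the restriction of [f] to [0, s], and [f^-] for the reverse path.
    Suppose that [f . g^-] has its class outside [H].

    The fibre over [x0] consists of the cosets of [H] in the fundamental group,
    and the basic neighbourhoods of the base coset are the images of the sets
    [H pi(c, V)] ([cover_basic_cstP]). Thus the T1 hypothesis yields a [V] with
    [f . g^-] outside [K = H pi(c, V)] ([fiberT1_separates]). Shrinking [V] by
    quasinormality keeps this property, and makes [K] a subgroup containing
    [H].

    Next, monodromy along the reverse of [f_s] sends the class of [f_s] to the
    base point of the fibre, so its continuity there says exactly that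
    [pi(f_s, U)] lies in [K] for some open [U] around [f s]
    ([monodromy_controls_loops]). The same [U] serves for every parameter near
    [s], since moving the base point inside [U] does not change [pi(f_s, U)]
    ([pi_path_shift], [loop_control_near]), and compactness gives a subdivision
    [t i = i / n] with sets [U i] that control all cells at once
    ([uniform_subdivision]).

    If now [h] runs through the same sets [U i] and agrees with [f] at the
    points [t i], then [h . f^-] is a product of loops, the [i]-th of which
    follows [f] to [f (t i)], goes along [h] and back along [f] within [U i],
    and returns; it lies in [pi(f_(t i), U i)]. So [h . f^-] is in the subgroup
    [K] ([pinned_path_in_H_pi]). Were [h . g^-] in [H], then
    [f . g^- = (h . f^-)^-1 (h . g^-)] would be in [K], contradicting the choice
    of [V]. *)

Set Implicit Arguments.
Unset Strict Implicit.
Unset Printing Implicit Defensive.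

Import Order.TTheory GRing.Theory Num.Theory.
Import numFieldNormedType.Exports.

Local Open Scope classical_set_scope.
Local Open Scope ring_scope.

(** * Subdividing the unit interval *)

Section UniformSubdivision.
Variable R : realType.

(** A Lebesgue number argument: a property of intervals that holds for all small
    intervals around each point holds for all cells of some uniform grid. *)
Lemma uniform_subdivision (P : R -> R -> Prop) :
  (forall s : R, 0 <= s <= 1 -> exists2 e : R, 0 < e &
     forall a b : R, s - e < a -> a <= b -> b < s + e -> P a b) ->
  exists n, (0 < n)%N /\
    forall i, (i < n)%N -> P (i%:R / n%:R) (i.+1%:R / n%:R).
Proof.
move=> locP.
pose Q (n : nat) (s : R) := forall a b : R,
  s - n.+1%:R^-1 < a -> a <= b -> b < s + n.+1%:R^-1 -> P a b.
have := @segment_compact R 0 1.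
move=> /compact_near_coveringP /(_ _ \oo Q _)[].
  move=> /= s; rewrite in_itv /= => /(locP (s : R))[e e0 eP].
  have e20 : 0 < e / 2 by rewrite divr_gt0.
  exists (ball s (e / 2), [set n | n.+1%:R^-1 < e / 2]).
    split; first exact: nbhsx_ballx.
    exact: near_infty_natSinv_lt (PosNum e20).
  move=> [s' n] /= []; rewrite /ball /= ltr_norml => /andP[h1 h2] hn.
  move=> a b; move: (n.+1%:R^-1 : R) hn h1 h2 => v; move: (s : R) eP => {}s eP.
  by move=> hn h1 h2 sa ab bs; apply: eP => //; lra.
(* The mesh is 1/(N+2), so that a cell fits strictly inside the open interval of
   radius 1/(N+1) around its left end. *)
move=> N _ NP; exists N.+2; split=> // i iN.
have n0 : 0 < N.+2%:R :> R by rewrite ltr0n.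
have d : i.+1%:R / N.+2%:R = i%:R / N.+2%:R + N.+2%:R^-1 :> R.
  by rewrite -natr1 mulrDl mul1r.
have i0 : 0 <= i%:R / N.+2%:R :> R by rewrite divr_ge0.
have i1 : i.+1%:R / N.+2%:R <= 1 :> R by rewrite ler_pdivrMr// mul1r ler_nat.
have vN0 : 0 < N.+2%:R^-1 :> R by rewrite invr_gt0.
have vN : N.+2%:R^-1 < N.+1%:R^-1 :> R by rewrite ltf_pV2 ?posrE ?ltr_nat.
move: (NP N (leqnn N) (i%:R / N.+2%:R)); rewrite /Q /= in_itv /=.
move: d i0 i1 vN0 vN; set a := i%:R / _; set b := i.+1%:R / _.
set v := _^-1; set w := _^-1 => d a0 b1 v0 vw.
by apply; lra.
Qed.

End UniformSubdivision.

(** * Restrictions of a path *)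

Section Subpaths.
Variables (R : realType) (X : topologicalType).
Local Notation I := (unit_interval R).

Definition subpath_fun (f : I -> X) (a b : R) (t : I) : X :=
  f (clamp ((b - a) * ival t + a)).

Section Subpath.
Variables (x y : X) (f : {path I from x to y}) (a b : R) (u v : X).
Hypotheses (fa : f (clamp a) = u) (fb : f (clamp b) = v).

Lemma segment_cts : continuous (fun t : I => (b - a) * ival t + a).
Proof. by apply: affine_continuous; exact: ival_continuous. Qed.

Lemma subpath_cts : continuous (subpath_fun f a b).
Proof.
by apply: comp_cts; [exact: (clamp_cts segment_cts)|exact: path_cts].
Qed.

Lemma subpath_zero : subpath_fun f a b zero = u.
Proof. by rewrite /subpath_fun ival0 mulr0 add0r. Qed.

Lemma subpath_one : subpath_fun f a b one = v.
Proof. by rewrite /subpath_fun ival1 mulr1 subrK. Qed.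

(** The endpoints are given up to equations, so that pieces of two paths which
    meet at a point compose without any transport between path types. *)
Definition subpath : {path I from u to v} :=
  mk_path subpath_cts subpath_zero subpath_one.

End Subpath.

Lemma subpathE x y (f : {path I from x to y}) a b u v
    (fa : f (clamp a) = u) (fb : f (clamp b) = v) t :
  subpath fa fb t = f (clamp ((b - a) * ival t + a)).
Proof. by []. Qed.

(** No order is imposed on [a], [b], [c]: both sides are reparametrizations of
    [f], by a broken line and by a segment with the same ends. *)
Lemma pclass_subpath_cat x y (f : {path I from x to y}) a b c u v w
    (fa : f (clamp a) = u) (fb : f (clamp b) = v) (fc : f (clamp c) = w) :
  pclass_mul (pclass (subpath fa fb)) (pclass (subpath fb fc)) =
  pclass (subpath fa fc).
Proof.
rewrite -pclass_cat; apply/pclassP.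
apply: (@path_homotopic_reparam _ _ _ _ _ _ f _ _
  (fun t : I => if ival t <= 2^-1 then (b - a) * (2 * ival t) + a
                else (c - b) * (2 * ival t - 1) + b)
  (fun t : I => (c - a) * ival t + a)).
- apply: (@continuous_paste R I R); first exact: ival_continuous.
  + by apply: affine_continuous; exact: dbl_cts.
  + by do 2!apply: affine_continuous; exact: ival_continuous.
  + by move=> t ->; field.
- exact: segment_cts.
- by rewrite ival0 ifT; [ring|lra].
- by rewrite ival1 ifF; [ring|apply/negP; lra].
- move=> t; rewrite path_catE; have /andP[t0 t1] := ival_itv t.
  by case: ifP => ht; rewrite subpathE clampK//; lra.
- by move=> t; rewrite subpathE.
Qed.

Lemma subpath_in x y (f : {path I from x to y}) a b u v
    (fa : f (clamp a) = u) (fb : f (clamp b) = v) (U : set X) :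
  (forall c : R, Num.min a b <= c <= Num.max a b -> U (f (clamp c))) ->
  forall t, U (subpath fa fb t).
Proof.
move=> fU t; rewrite subpathE; apply: fU; have /andP[t0 t1] := ival_itv t.
rewrite ge_min le_max; case: (lerP a b) => ab; nra.
Qed.

End Subpaths.

(** * The product of H with the group of small loops *)

Local Notation H_pi H V :=
  (set_mulg [set` H] (pi_path (path_cst _ _) V)).

Section LoopSubgroups.
Variables (R : realType) (X : topologicalType) (x0 : X).
Local Notation I := (unit_interval R).
Implicit Types (x y : X) (U V : set X).

Lemma pi_pathP x (f : {path I from x0 to x}) U (u : pi1 R x0) :
  pi_path f U u <-> exists2 d : {path I from x to x}, (forall t, U (d t)) &
    u = pclass_mul (pclass_mul (pclass f) (pclass d)) (pclass_inv (pclass f)).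
Proof.
split=> [[d [Ud ->]]|[d Ud ->]]; exists d;
  by rewrite ?pclass_cat ?pclass_rev.
Qed.

Lemma pi_path_cst U (u : pi1 R x0) :
  pi_path (path_cst R x0) U u <->
  exists2 d : {path I from x0 to x0}, (forall t, U (d t)) & u = pclass d.
Proof.
have E (d : {path I from x0 to x0}) :
    pclass_mul (pclass_mul (pclass (path_cst R x0)) (pclass d))
      (pclass_inv (pclass (path_cst R x0))) = pclass d.
  rewrite -/(pclass_one R x0) pclass_mul1p -(pclass_invP (pclass_mul1p _)).
  exact: pclass_mulp1.
by rewrite pi_pathP; split=> -[d Ud ->]; exists d; rewrite ?E.
Qed.

Section PiPathSubgroup.
Variables (x : X) (f : {path I from x0 to x}) (U : set X).

Lemma pi_path1 : U x -> pi_path f U 1%g.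
Proof.
move=> Ux; apply/pi_pathP; exists (path_cst R x) => //.
by rewrite -/(pclass_one R x) pclass_mulp1 pclass_mulV.
Qed.

Lemma pi_pathM (u v : pi1 R x0) :
  pi_path f U u -> pi_path f U v -> pi_path f U (u * v)%g.
Proof.
move=> /pi_pathP[d Ud ->] /pi_pathP[e Ue ->]; apply/pi_pathP.
exists (path_cat d e); first exact: path_cat_in.
by rewrite pi1_mulE pclass_cat !pclass_mulA pclass_mulKV.
Qed.

Lemma pi_pathV (u : pi1 R x0) : pi_path f U u -> pi_path f U u^-1%g.
Proof.
move=> /pi_pathP[d Ud ->]; apply/pi_pathP.
exists (path_rev d); first by move=> t; rewrite path_revE.
by rewrite pi1_invE pclass_rev !pclass_invM pclass_invK pclass_mulA.
Qed.

End PiPathSubgroup.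

(** Lengthening the tail [f] by a path inside [U] only conjugates the loops in [U]
    by that path. *)
Lemma pi_path_shift x y (f : {path I from x0 to x}) (k : {path I from x to y})
    (g : {path I from x0 to y}) U :
  (forall t, U (k t)) -> pclass g = pclass_mul (pclass f) (pclass k) ->
  pi_path g U `<=` pi_path f U.
Proof.
move=> Uk gE u /pi_pathP[d Ud ->]; apply/pi_pathP.
exists (path_cat (path_cat k d) (path_rev k)).
  do 2?apply: path_cat_in => //; by move=> t; rewrite path_revE.
by rewrite gE !pclass_cat pclass_rev pclass_invM !pclass_mulA.
Qed.

Variable H : groupClosed (pi1 R x0).

Definition quasinormal_at V :=
  set_mulg [set` H] (pi_path (path_cst R x0) V) =
  set_mulg (pi_path (path_cst R x0) V) [set` H].

Lemma H_piP V (u : pi1 R x0) :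
  H_pi H V u <-> exists h p, [/\ h \in H, pi_path (path_cst R x0) V p & u = (h * p)%g].
Proof.
split=> [[h Hh [p Pp <-]]|[h [p [Hh Pp ->]]]]; first by exists h, p.
by exists h => //; exists p.
Qed.

Lemma H_pi1 V : V x0 -> H_pi H V 1%g.
Proof.
move=> Vx; apply/H_piP; exists 1%g, 1%g.
by rewrite mulg1 (@gpred1 _ H); split=> //; exact: pi_path1.
Qed.

(** This is what quasinormality is for: it reorders the factors, which makes
    [H_pi H V] a subgroup. *)
Lemma H_pi_swap V (h p : pi1 R x0) : quasinormal_at V -> h \in H ->
  pi_path (path_cst R x0) V p -> H_pi H V (p * h)%g.
Proof. by move=> -> Hh Pp; exists p => //; exists h. Qed.

Lemma H_piM V (u v : pi1 R x0) : quasinormal_at V ->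
  H_pi H V u -> H_pi H V v -> H_pi H V (u * v)%g.
Proof.
move=> qV /H_piP[h [p [Hh Pp ->]]] /H_piP[h' [p' [Hh' Pp' ->]]].
have /H_piP[h2 [p2 [Hh2 Pp2 E]]] := H_pi_swap qV Hh' Pp.
apply/H_piP; exists (h * h2)%g, (p2 * p')%g; split.
- exact: (@gpredM _ H).
- exact: pi_pathM.
- by rewrite !mulgA -(mulgA h p h') E !mulgA.
Qed.

Lemma H_piVM V (u h : pi1 R x0) : quasinormal_at V ->
  H_pi H V u -> h \in H -> H_pi H V (u^-1 * h)%g.
Proof.
move=> qV /H_piP[k [p [Hk Pp ->]]] Hh; rewrite invgM -mulgA.
apply: (H_pi_swap qV); last exact: pi_pathV.
by apply: (@gpredM _ H) => //; exact: (@gpredVr _ H).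
Qed.

End LoopSubgroups.

(** * The fibre over the base point and monodromy *)

Section CoverTopology.
Variables (R : realType) (X : topologicalType) (x0 : X).
Variable H : groupClosed (pi1 R x0).
Local Notation I := (unit_interval R).
Implicit Types (x y : X) (U V : set X).

Lemma cover_basic_open x (f : {path I from x0 to x}) U :
  open U -> U x -> open (cover_basic H f U).
Proof.
move=> oU Ux; exists [set (existT _ x f : path_from R x0, U)].
  by move=> _ ->.
by rewrite bigcup_set1.
Qed.

(** The topology only provides a basic set around some other path [g]; it is
    also the basic set around any class that it contains. *)
Lemma open_cover_basic x (f : {path I from x0 to x}) (O : set (Defs.cover H)) :
  open O -> O (cover_class H f) ->
  exists U, [/\ open U, U x & cover_basic H f U `<=` O].
Proof.
move=> [D' D'D <-] [[[y g] U] D'gU /=].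
have [/= oU Uy] := D'D _ D'gU.
move=> [z [k [Uk E]]]; have xz := cover_class_eqx E; subst z.
exists U; split=> //; first by have := Uk (clamp 1); rewrite path1.
apply: subset_trans (bigcup_sup D'gU).
rewrite (cover_basic_eq U E); exact: cover_basic_trans.
Qed.

(** This turns the topology of the fibre over [x0] into algebra: a coset
    [H g] is near the base coset when [g] is a small loop modulo [H]. *)
Lemma cover_basic_cstP V (g : {path I from x0 to x0}) :
  cover_basic H (path_cst R x0) V (cover_class H g) <->
  H_pi H V (pclass g : pi1 R x0).
Proof.
split=> [[y [k [Vk E]]]|/H_piP[h [p [Hh /pi_path_cst[d Vd ->] E]]]].
  have ey := cover_class_eqx E; subst y; apply/H_piP.
  move/cover_classP: E.
  rewrite pclass_cat pclass_rev pclass_cat -/(pclass_one R x0) pclass_mul1p.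
  set h := pclass_mul _ _ => Hh; exists h, (pclass k); split=> //.
    by apply/pi_path_cst; exists k.
  by rewrite pi1_mulE /h pclass_mulKV.
exists x0, d; split=> //; apply/cover_classP.
rewrite pclass_cat pclass_rev pclass_cat -/(pclass_one R x0) pclass_mul1p E.
by rewrite pi1_mulE pclass_mulK.
Qed.

Lemma fiberT1_separates (g : pi1 R x0) : accessible_space (fiber H x0) ->
  g \notin H -> exists V, [/\ open V, V x0 & ~ H_pi H V g].
Proof.
move=> T1 gH.
pose u : fiber H x0 := SigSub (fiber_class H (path_cst R x0)).
pose v : fiber H x0 := SigSub (fiber_class H (prepr g)).
have uv : u != v.
  apply/eqP => /(congr1 val) /= /esym/cover_classP.
  rewrite pclass_cat pclass_rev preprK -/(pclass_one R x0).
  by rewrite -(pclass_invP (pclass_mul1p _)) pclass_mulp1; apply/negP.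
have [A [+ uA vA]] := T1 _ _ uv; case=> O oO OA.
move: uA vA; rewrite !inE -OA => Ou nOv.
have [V [oV Vx VO]] := open_cover_basic oO Ou.
exists V; split=> // gV; apply: nOv; apply: VO.
by apply/cover_basic_cstP; rewrite preprK.
Qed.

(** Monodromy along the reverse of [f] takes the class of [f . d] to that of
    [f . d . f^-]. For a small loop [d] the former is close to the class of [f],
    so the latter is close to the base point of the fibre. *)
Lemma monodromy_controls_loops x (f : {path I from x0 to x}) V :
  {for SigSub (fiber_class H f) : fiber H x,
    continuous (monodromy H (path_rev f))} ->
  open V -> V x0 -> exists U, [/\ open U, U x & pi_path f U `<=` H_pi H V].
Proof.
move=> cf oV Vx.
pose W : set (fiber H x0) := set_val @^-1` cover_basic H (path_cst R x0) V.
have : nbhs (monodromy H (path_rev f) (SigSub (fiber_class H f))) W.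
  apply: open_nbhs_nbhs; split.
    by exists (cover_basic H (path_cst R x0) V) => //; exact: cover_basic_open.
  rewrite /W /= [X in cover_basic _ _ _ X]monodromy_class.
  apply/cover_basic_cstP; rewrite pclass_cat pclass_rev pclass_mulV.
  exact: H_pi1.
move=> /cf; rewrite /nbhs /= => -[B [+ + +]]; case=> O oO <- /= Of OW.
have [U [oU Ux UO]] := open_cover_basic oO Of.
exists U; split=> // u [d [Ud ->]].
apply/cover_basic_cstP; rewrite -monodromy_class.
by apply: OW => /=; apply: UO; exists x, d.
Qed.

End CoverTopology.

(** * Paths that agree with a given path on a grid *)

Section PinnedPaths.
Variables (R : realType) (X : topologicalType) (x0 : X).
Variable H : groupClosed (pi1 R x0).
Local Notation I := (unit_interval R).

(** With [A i] and [B i] the classes of the restrictions of [f] and [h] to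
    [0, t i], one cell changes [B i (A i)^-1] by a factor on the right:
    [B (i+1) (A (i+1))^-1 = (B i (A i)^-1) (A i (c d^-1) (A i)^-1)], where [c]
    and [d] are the pieces of [h] and [f] over the cell. The factor lies in
    [pi(f_(t i), U i)]. *)
Lemma pinned_path_in_H_pi (V : set X) (x : X) (f h : {path I from x0 to x})
    (t : nat -> R) (U : nat -> set X) n :
  quasinormal_at H V -> V x0 -> t 0%N = 0 -> t n = 1 ->
  (forall i, (i < n)%N -> t i <= t i.+1) ->
  (forall i, (i < n)%N ->
    pi_path (subpath (path0 f) (erefl (f (clamp (t i))))) (U i) `<=` H_pi H V) ->
  (forall i, (i < n)%N ->
    forall s : R, t i <= s <= t i.+1 -> U i (f (clamp s))) ->
  (forall i, (i < n)%N ->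
    forall s : R, t i <= s <= t i.+1 -> U i (h (clamp s))) ->
  (forall i, (i <= n)%N -> h (clamp (t i)) = f (clamp (t i))) ->
  H_pi H V (pclass (path_cat h (path_rev f)) : pi1 R x0).
Proof.
move=> qV Vx t0 tn tS piU fU hU hf.
(* The common endpoint [y] is a variable so that at the last grid point it can
   be taken to be the endpoint [x] of the path types. *)
have step i y (ey : f (clamp (t i)) = y) (e : h (clamp (t i)) = y) :
    (i <= n)%N ->
    H_pi H V (pclass_mul (pclass (subpath (path0 h) e))
      (pclass_inv (pclass (subpath (path0 f) ey))) : pi1 R x0).
  elim: i y ey e => [|i IH] y ey e ilen.
    have ex : x0 = y by rewrite -ey t0 path0.
    case: y / ex ey e => ey e.
    have E (k : {path I from x0 to x}) (ek : k (clamp (t 0%N)) = x0) :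
        pclass (subpath (path0 k) ek) = pclass_one R x0.
      congr (pclass _); apply/path_eqP => s.
      by rewrite subpathE t0 subrr mul0r add0r path0.
    by rewrite !E pclass_mulV; exact: H_pi1.
  have hfi := hf i (ltnW ilen).
  have := IH _ erefl hfi (ltnW ilen).
  rewrite -(pclass_subpath_cat (path0 h) hfi e).
  rewrite -(pclass_subpath_cat (path0 f) (erefl (f (clamp (t i)))) ey).
  set A := pclass (subpath _ hfi); set B := pclass (subpath (path0 f) erefl).
  set C := subpath hfi e; set D := subpath (erefl (f (clamp (t i)))) ey => KAB.
  have -> : pclass_mul (pclass_mul A (pclass C))
     (pclass_inv (pclass_mul B (pclass D))) =
     pclass_mul (pclass_mul A (pclass_inv B))
      (pclass_mul (pclass_mul B (pclass (path_cat C (path_rev D))))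
         (pclass_inv B)).
    rewrite pclass_invM pclass_cat pclass_rev !pclass_mulA.
    by rewrite pclass_mulKV.
  apply: (H_piM qV KAB); apply: (piU i ilen); apply/pi_pathP.
  exists (path_cat C (path_rev D)) => //.
  have tle := tS i ilen; apply: path_cat_in.
    by apply: subpath_in => c; rewrite min_l// max_r//; exact: hU.
  move=> s; rewrite path_revE; apply: subpath_in => c.
  by rewrite min_l// max_r//; exact: fU.
have fE : f (clamp (t n)) = x by rewrite tn path1.
have hE : h (clamp (t n)) = x by rewrite tn path1.
have := step n x fE hE (leqnn n); rewrite pclass_cat pclass_rev.
have E (k : {path I from x0 to x}) (ek : k (clamp (t n)) = x) :
   subpath (path0 k) ek = k.
  by apply/path_eqP => s; rewrite subpathE tn subr0 mul1r addr0 ivalK.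
by rewrite !E.
Qed.

(** [U] is the neighbourhood given at [s]; for a nearby [a] the restriction of [f]
    to [0, a] differs from that to [0, s] by a piece of [f] inside [U]. *)
Lemma loop_control_near (x : X) (f : {path I from x0 to x})
    (K : set (pi1 R x0)) :
  (forall s : R, exists U, [/\ open U, U (f (clamp s)) &
     pi_path (subpath (path0 f) (erefl (f (clamp s)))) U `<=` K]) ->
  forall s : R, exists2 e : R, 0 < e &
    forall a b : R, s - e < a -> a <= b -> b < s + e ->
    exists U, [/\ open U, forall c : R, a <= c <= b -> U (f (clamp c)) &
      pi_path (subpath (path0 f) (erefl (f (clamp a)))) U `<=` K].
Proof.
move=> ctl s; have [U [oU Us UK]] := ctl s.
have : \forall s' \near s, U (f (clamp s')).
  have cfs : {for s, continuous (fun r => f (clamp r))}.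
    by apply: comp_cts; [exact: clamp_continuous|exact: path_cts].
  by apply: cfs; exact: open_nbhs_nbhs.
move=> /nbhs_ballP[e /= e0 eU]; exists e => // a b sa ab bs.
have Uc c : s - e < c < s + e -> U (f (clamp c)).
  by move=> ?; apply: eU; rewrite /ball /= ltr_norml; lra.
exists U; split=> //; first by move=> c ?; apply: Uc; lra.
apply: subset_trans UK.
have Uk : forall t, U (subpath (erefl (f (clamp s))) (erefl (f (clamp a))) t).
  apply: subpath_in => c; rewrite ge_min le_max => ?; apply: Uc.
  by case: (lerP s a) => ?; lra.
by apply: pi_path_shift Uk _; rewrite pclass_subpath_cat.
Qed.

End PinnedPaths.

Theorem theorem4p3 (R : realType) (X : topologicalType) (x0 : X)
    (H : groupClosed (pi1 R x0))
    (Xpc : path_connected R X)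
    (Hlqn : locally_quasinormal_cst H)
    (fiberT1 : accessible_space (fiber H x0))
    (mono_cts : forall (x : X) (b : {path (unit_interval R) from x to x0}),
       continuous (monodromy H b)) :
  homotopically_path_hausdorff H.
Proof.
move=> x f g fgH.
have [V0 [oV0 V0x V0fg]] := fiberT1_separates fiberT1 fgH.
have [V [oV Vx VV0 qV]] := Hlqn V0 oV0 V0x.
(* Shrinking [V0] to [V] shrinks the product set, which still avoids [f . g^-]. *)
have Vfg : ~ H_pi H V (pclass (path_cat f (path_rev g)) : pi1 R x0).
  move=> /H_piP[h [p [Hh [d [Vd pE]] E]]]; apply: V0fg; apply/H_piP.
  by exists h, p; split=> //; exists d; split=> // t; exact: VV0.
have ctl s := monodromy_controls_loops
  (@mono_cts _ (path_rev (subpath (path0 f) (erefl (f (clamp s)))))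
     (SigSub (fiber_class H _))) oV Vx.
have near_ctl := loop_control_near ctl.
have [n [n0 nP]] := uniform_subdivision (fun s _ => near_ctl s).
have n0R : 0 < n%:R :> R by rewrite ltr0n.
pose t i : R := i%:R / n%:R.
have t01 i : (i <= n)%N -> 0 <= t i <= 1.
  by move=> ilen; rewrite divr_ge0//= ler_pdivrMr// mul1r ler_nat.
have tS i : t i < t i.+1 by rewrite ltr_pM2r ?invr_gt0// ltr_nat.
have tt0 : t 0%N = 0 by rewrite /t mul0r.
have ttn : t n = 1 by rewrite /t divff// gt_eqF.
have /boolp.choice[U UP] : forall i, exists Ui : set X, (i < n)%N ->
    [/\ open Ui, forall c : R, t i <= c <= t i.+1 -> Ui (f (clamp c)) &
      pi_path (subpath (path0 f) (erefl (f (clamp (t i))))) Ui `<=` H_pi H V].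
  by move=> i; case: (ltnP i n) => [/nP[Ui UiP]|_]; [exists Ui|exists setT].
have tin i s : (i < n)%N -> t i <= s <= t i.+1 -> 0 <= s <= 1.
  by move=> ilen; have := t01 i (ltnW ilen); have := t01 i.+1 ilen; lra.
exists n, (fun i => clamp (t i)), U; split.
- by rewrite tt0.
- by rewrite ttn.
- by move=> i ilen; rewrite !clampK ?t01// ltnW.
- move=> i ilen; have [oU fU _] := UP i ilen; split=> // s.
  by rewrite !clampK ?t01 ?(ltnW ilen)// => /fU; rewrite ivalK.
- move=> h hU hf; apply/negP => hgH; apply: Vfg.
  have hfK : H_pi H V (pclass (path_cat h (path_rev f)) : pi1 R x0).
    apply: (pinned_path_in_H_pi (t := t) (U := U) (n := n)) => //.
    + by move=> i _; exact: ltW.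
    + by move=> i /UP[].
    + by move=> i /UP[].
    + move=> i ilen s sti; apply: hU (ilen) _ _.
      by rewrite !clampK ?t01 ?(ltnW ilen) ?(tin i).
  have -> : (pclass (path_cat f (path_rev g)) : pi1 R x0) =
      ((pclass (path_cat h (path_rev f)) : pi1 R x0)^-1 *
        (pclass (path_cat h (path_rev g)) : pi1 R x0))%g.
    rewrite pi1_mulE pi1_invE !pclass_cat !pclass_rev pclass_invM pclass_invK.
    by rewrite pclass_mulA pclass_mulKV.
  exact: H_piVM.
Qed.
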